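(* Let $n\ge 2$ and $c\ge 2$. Let $a\in\mathbb{B}^n$ and let $f:\mathbb{B}^n\to\mathbb{B}^n=f(\mathbb{B}^n)$ be a Möbius transformation with $f(0)=a$. Then, for all $x,y\in\mathbb{B}^n\setminus\{0\}$, $$h_{\mathbb{B}^n\setminus\{a\},c}(f(x),f(y))\le (1+|a|)\,h_{\mathbb{B}^n\setminus\{0\},c}(x,y).$$
   Context: $\mathbb{R}^n$ carries the Euclidean norm $|\cdot|$, and $\mathbb{B}^n=\{x\in\mathbb{R}^n:|x|<1\}$ is the open unit ball. For a nonempty open set $D\subset\mathbb{R}^n$ with nonempty boundary $\partial D$ (taken in $\mathbb{R}^n$), let $d_D(x)=\inf_{z\in\partial D}|x-z|$ and, for $x,y\in D$, $$h_{D,c}(x,y)=\log\left(1+c\,\frac{|x-y|}{\sqrt{d_D(x)\,d_D(y)}}\right).$$ In particular, for $a\in\mathbb{B}^n$ and $D=\mathbb{B}^n\setminus\{a\}$, the boundary is $\{a\}\cup\{z:|z|=1\}$ and $d_D(x)=\min\{|x-a|,\,1-|x|\}$ for $x\in D$. For $c\ge 2$, $h_{D,c}$ is a metric on $D$. A Möbius transformation of a domain onto another is the restriction to the domain of a Möbius transformation of $\overline{\mathbb{R}^n}=\mathbb{R}^n\cup\{\infty\}$ (a finite composition of reflections in hyperplanes and inversions in spheres; orientation-reversing maps are allowed). *)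

(* Defs.v *)
From HB Require Import structures.
From mathcomp Require Import all_boot all_order all_algebra.
From mathcomp Require Import all_classical all_reals all_analysis.

Set Implicit Arguments.
Unset Strict Implicit.
Unset Printing Implicit Defensive.

Import Order.TTheory GRing.Theory Num.Theory.
Import numFieldNormedType.Exports.

Local Open Scope classical_set_scope.
Local Open Scope ring_scope.

Definition dot (R : realType) (n : nat) (x y : 'rV[R]_n) : R :=
  \sum_(i < n) x 0 i * y 0 i.

(* The library norm `|x| on 'rV[R]_n is the sup norm, hence this definition.
   The two norms induce the same topology, so [closure] and [interior] below
   are the Euclidean ones. *)
Definition enorm (R : realType) (n : nat) (x : 'rV[R]_n) : R :=
  Num.sqrt (dot x x).

Definition unit_ball (R : realType) (n : nat) : set 'rV[R]_n :=
  [set x | enorm x < 1].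
Arguments unit_ball : clear implicits.

Definition boundary (T : topologicalType) (D : set T) : set T :=
  closure D `\` interior D.

Definition bdist (R : realType) (n : nat) (D : set 'rV[R]_n)
    (x : 'rV[R]_n) : R :=
  inf [set enorm (x - z) | z in boundary D].

Definition hmetric (R : realType) (n : nat) (D : set 'rV[R]_n) (c : R)
    (x y : 'rV[R]_n) : R :=
  ln (1 + c * (enorm (x - y) / Num.sqrt (bdist D x * bdist D y))).

(* R^n together with a point at infinity: [Some x] is the finite point x and
   [None] is infinity. *)
Definition ext_space (R : realType) (n : nat) : Type :=
  one_point_compactification 'rV[R]_n.

(* Reflection in the hyperplane {x | dot x u = t} (with infinity adjoined),
   a hyperplane when u != 0. *)
Definition hyperplane_reflection (R : realType) (n : nat) (u : 'rV[R]_n)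
    (t : R) (p : ext_space R n) : ext_space R n :=
  match p with
  | Some x => Some (x - (2 * (dot x u - t) / dot u u) *: u)
  | None => None
  end.

(* Inversion in the sphere with centre b and radius r > 0. *)
Definition sphere_inversion (R : realType) (n : nat) (b : 'rV[R]_n)
    (r : R) (p : ext_space R n) : ext_space R n :=
  match p with
  | Some x => if x == b then None
              else Some (b + (r ^+ 2 / enorm (x - b) ^+ 2) *: (x - b))
  | None => Some b
  end.

Inductive mobius (R : realType) (n : nat) :
    (ext_space R n -> ext_space R n) -> Prop :=
| mobius_id : mobius id
| mobius_hyperplane (u : 'rV[R]_n) (t : R) (g : ext_space R n -> ext_space R n) :
    u != 0 -> mobius g -> mobius (hyperplane_reflection u t \o g)
| mobius_sphere (b : 'rV[R]_n) (r : R) (g : ext_space R n -> ext_space R n) :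
    0 < r -> mobius g -> mobius (sphere_inversion b r \o g).

(* f is a total function, of which only the restriction to D matters. *)
Definition mobius_onto (R : realType) (n : nat) (D D' : set 'rV[R]_n)
    (f : 'rV[R]_n -> 'rV[R]_n) : Prop :=
  (exists2 g : ext_space R n -> ext_space R n,
     mobius g & forall x, D x -> g (Some x) = Some (f x))
  /\ f @` D = D'.

(* Main.v *)
(* Represent a point of R^n with infinity by the null line through
   (|x|^2, x, 1) for a form of signature (n + 1, 1).  Hyperplane reflections and
   sphere inversions are induced by linear reflections, so every Mobius map g is
   induced by a bijective isometry L.  If g maps the unit ball onto itself, the
   quadratic function obtained by pulling back 1 - |x|^2 vanishes on the unit
   sphere: at a sphere point where it does not, g would take a value inside the
   ball, contradicting injectivity.  So L preserves the vector of the ball up to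
   sign, and |f x - f y|^2 / ((1 - |f x|^2) (1 - |f y|^2)) = |x - y|^2 /
   ((1 - |x|^2) (1 - |y|^2)).  The problem becomes the pointwise estimate
   (1 - |f x|^2) d(x) <= (1 + |a|) (1 - |x|^2) d'(f x) for the boundary
   distances d and d'; Bernoulli's inequality ln (1 + k t) <= k ln (1 + t)
   then gives the claim. *)
Require Import Defs.
From mathcomp Require Import all_boot all_order all_algebra.
From mathcomp Require Import all_classical all_reals all_analysis.
From mathcomp Require Import ring lra.

Import Order.TTheory GRing.Theory Num.Theory.
Import numFieldNormedType.Exports.

Local Open Scope classical_set_scope.
Local Open Scope ring_scope.

(** * The Euclidean inner product and norm *)

Section Euclidean.
Context {R : realType} {n : nat}.
Implicit Types (x y z u v : 'rV[R]_n) (k : R).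

Lemma dotC x y : dot x y = dot y x.
Proof. by apply: eq_bigr => i _; rewrite mulrC. Qed.

Lemma dotDl x y z : dot (x + y) z = dot x z + dot y z.
Proof. by rewrite -big_split; apply: eq_bigr => i _; rewrite mxE mulrDl. Qed.

Lemma dotZl k x y : dot (k *: x) y = k * dot x y.
Proof. by rewrite /dot mulr_sumr; apply: eq_bigr => i _; rewrite mxE mulrA. Qed.

Lemma dotNl x y : dot (- x) y = - dot x y.
Proof. by rewrite -scaleN1r dotZl mulN1r. Qed.

Lemma dotDr x y z : dot x (y + z) = dot x y + dot x z.
Proof. by rewrite !(dotC x) dotDl. Qed.

Lemma dotZr k x y : dot x (k *: y) = k * dot x y.
Proof. by rewrite !(dotC x) dotZl. Qed.

Lemma dotNr x y : dot x (- y) = - dot x y.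
Proof. by rewrite !(dotC x) dotNl. Qed.

Lemma dot0l x : dot 0 x = 0.
Proof. by rewrite -(scale0r 0) dotZl mul0r. Qed.

Lemma dot0r x : dot x 0 = 0.
Proof. by rewrite dotC dot0l. Qed.

Definition dotE := (dotDl, dotDr, dotNl, dotNr, dotZl, dotZr, dot0l, dot0r).

Lemma dot_ge0 x : 0 <= dot x x.
Proof. by apply: sumr_ge0 => i _; rewrite -expr2 sqr_ge0. Qed.

Lemma dot_eq0 x : (dot x x == 0) = (x == 0).
Proof.
apply/idP/eqP => [|->]; last by rewrite dot0l.
rewrite psumr_eq0 => [/allP x0|i _]; last by rewrite -expr2 sqr_ge0.
apply/rowP => i; rewrite mxE; apply/eqP.
by have := x0 i (mem_index_enum _); rewrite mulf_eq0 orbb.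
Qed.

Lemma enorm_ge0 x : 0 <= enorm x. Proof. exact: sqrtr_ge0. Qed.

Lemma sqr_enorm x : enorm x ^+ 2 = dot x x.
Proof. by rewrite sqr_sqrtr ?dot_ge0. Qed.

Lemma enorm0 : enorm (0 : 'rV[R]_n) = 0.
Proof. by rewrite /enorm dot0l sqrtr0. Qed.

Lemma enorm_gt0 x : (0 < enorm x) = (x != 0).
Proof. by rewrite sqrtr_gt0 lt0r dot_ge0 andbT dot_eq0. Qed.

Lemma enormZ k x : enorm (k *: x) = `|k| * enorm x.
Proof. by rewrite /enorm !dotE mulrA -expr2 sqrtrM ?sqr_ge0// sqrtr_sqr. Qed.

Lemma enormN x : enorm (- x) = enorm x.
Proof. by rewrite /enorm !dotE opprK. Qed.

(** Cauchy-Schwarz: the vector |y| x - |x| y has squared length 2 |x| |y| (|x| |y| - [dot x y]),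
    which is nonnegative. *)
Lemma dot_le_enorm x y : dot x y <= enorm x * enorm y.
Proof.
have [->|x0] := eqVneq x 0; first by rewrite !dotE enorm0 mul0r.
have [->|y0] := eqVneq y 0; first by rewrite !dotE enorm0 mulr0.
move: x0 y0; rewrite -!enorm_gt0 => x0 y0.
have := dot_ge0 (enorm y *: x - enorm x *: y).
rewrite !dotE -!sqr_enorm (dotC y x) => h.
rewrite -(ler_pM2l (mulr_gt0 x0 y0)); nra.
Qed.

Lemma enorm_triangle x y : enorm (x + y) <= enorm x + enorm y.
Proof.
rewrite -(ler_pXn2r (_ : 0 < 2)%N) ?nnegrE ?addr_ge0 ?enorm_ge0//.
rewrite sqr_enorm !dotE sqrrD !sqr_enorm (dotC y x).
by have := dot_le_enorm x y; lra.
Qed.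

Lemma enormB x y : enorm (x - y) = enorm (y - x).
Proof. by rewrite -enormN opprB. Qed.

Lemma lerB_enorm x y : enorm x - enorm y <= enorm (x - y).
Proof. by rewrite lerBlDr -{1}(subrK y x) enorm_triangle. Qed.

Lemma unit_ballE x : unit_ball R n x <-> dot x x < 1.
Proof.
rewrite /unit_ball/= -sqr_enorm; split=> h.
  by rewrite exprn_ilt1 ?enorm_ge0.
by rewrite -(ltr_pXn2r (_ : 0 < 2)%N) ?nnegrE ?enorm_ge0 ?expr1n.
Qed.

Lemma exists_enorm1 : (0 < n)%N -> exists e : 'rV[R]_n, enorm e = 1.
Proof.
move=> n0; pose e : 'rV[R]_n := delta_mx 0 (Ordinal n0).
have : e != 0.
  apply/eqP => /rowP/(_ (Ordinal n0)); rewrite !mxE !eqxx => /eqP.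
  by rewrite oner_eq0.
rewrite -enorm_gt0 => e0; exists ((enorm e)^-1 *: e).
by rewrite enormZ gtr0_norm ?invr_gt0// mulVf ?gt_eqF.
Qed.

Lemma enorm_continuous : continuous (@enorm R n).
Proof.
move=> x; apply: continuous_comp; last exact: sqrt_continuous.
have := @continuous_big R 'I_n +%R 0 xpredT (@add_continuous R^o) 'rV[R]_n
  (index_enum 'I_n) (fun i y => y 0 i * y 0 i); apply => i _ y.
by apply: (@continuousM _ 'rV[R]_n); apply: coord_continuous.
Qed.

End Euclidean.

(** * The null-cone model of Möbius maps *)

Section Conformal.
Context {R : realType} {n : nat}.

(* A point of R^n with infinity adjoined is the line spanned by a null vector
   of the form [lform], with coordinates ordered so that x corresponds to
   (|x|^2, x, 1). *)
Local Notation V := (R^o * 'rV[R]_n * R^o)%type.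
Implicit Types (X Y Z U : V) (x y : 'rV[R]_n) (p : ext_space R n).

(** The weight 1/2 makes every (|x|^2, x, 1) a null vector. *)
Definition lform X Y : R := dot X.1.2 Y.1.2 - (X.1.1 * Y.2 + X.2 * Y.1.1) / 2.

Definition nlift p : V :=
  if p is Some x then (dot x x, x, 1) else (1, 0, 0).

Lemma lformDl X Y Z : lform (X + Y) Z = lform X Z + lform Y Z.
Proof. by rewrite /lform /= !dotE; ring. Qed.

Lemma lformZl k X Y : lform (k *: X) Y = k * lform X Y.
Proof. by rewrite /lform /= !dotE /GRing.scale /=; ring. Qed.

Lemma lformC X Y : lform X Y = lform Y X.
Proof. by rewrite /lform dotC; ring. Qed.

Lemma lformDr X Y Z : lform X (Y + Z) = lform X Y + lform X Z.
Proof. by rewrite !(lformC X) lformDl. Qed.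

Lemma lformZr k X Y : lform X (k *: Y) = k * lform X Y.
Proof. by rewrite !(lformC X) lformZl. Qed.

Definition lreflection U X : V := X - (2 * lform X U / lform U U) *: U.

Lemma lform_lreflection U X Y : lform U U != 0 ->
  lform (lreflection U X) (lreflection U Y) = lform X Y.
Proof.
move=> U0.
have E Z : lreflection U Z = Z + - (2 * lform Z U / lform U U) *: U.
  by rewrite scaleNr.
rewrite !E !(lformDl, lformZl, lformDr, lformZr).
by rewrite [lform U Y]lformC; field.
Qed.

Lemma lreflectionK U : lform U U != 0 -> involutive (lreflection U).
Proof.
move=> U0 X; rewrite {1}/lreflection.
have -> : lform (lreflection U X) U = - lform X U.
  by rewrite /lreflection -scaleNr lformDl lformZl; field.
by rewrite /lreflection mulrN mulNr scaleNr opprK subrK.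
Qed.

Lemma lform_nlift x y :
  lform (nlift (Some x)) (nlift (Some y)) = - dot (x - y) (x - y) / 2.
Proof. by rewrite /lform /= !dotE (dotC y x); field. Qed.

Lemma lreflectionE U X k : 2 * lform X U / lform U U = k ->
  lreflection U X =
    (X.1.1 - k * U.1.1 : R, X.1.2 - k *: U.1.2, X.2 - k * U.2 : R).
Proof. by move=> <-. Qed.

(** The mirror vector (2 t, u, 0) pairs with the lift of x to [dot x u - t], so it is orthogonal to
    the lifts of the points of the hyperplane. *)
Lemma nlift_hyperplane_reflection u (t : R) p : u != 0 ->
  lreflection (2 * t, u, 0) (nlift p) = nlift (hyperplane_reflection u t p).
Proof.
rewrite -dot_eq0 => u0; case: p => [x|] /=.
  rewrite (@lreflectionE _ _ (2 * (dot x u - t) / dot u u)) /lform /=.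
    by congr (_, _, _); rewrite ?dotE ?(dotC u x); field.
  by field.
rewrite (@lreflectionE _ _ 0) /lform /=.
  by rewrite !mul0r scale0r !subr0.
by rewrite dotE; field.
Qed.

(** The mirror vector pairs with the lift of x to (r^2 - |x - b|^2) / 2, which vanishes on the
    sphere. The scalar [l] is the last coordinate of the reflected lift when the image is finite,
    and its first coordinate when the image is infinity. *)
Lemma nlift_sphere_inversion b (r : R) p : 0 < r ->
  exists2 l : R, l != 0 &
    lreflection (dot b b - r ^+ 2, b, 1) (nlift p)
      = l *: nlift (sphere_inversion b r p).
Proof.
move=> r0; have r0' : r != 0 by rewrite gt_eqF.
have scE k (s s' : R) v :
  k *: ((s, v, s') : V) = ((k * s : R), k *: v, (k * s' : R)) by [].
have UU : lform (dot b b - r ^+ 2, b, 1) (dot b b - r ^+ 2, b, 1) = r ^+ 2.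
  by rewrite /lform /=; field.
case: p => [x|] /=; last first.
  exists (r ^- 2); first by rewrite invr_eq0 expf_eq0.
  rewrite (@lreflectionE _ _ (- r ^- 2)) ?UU /lform /= ?scE.
    by congr (_, _, _); rewrite ?sub0r ?scaleNr ?opprK//; field.
  by rewrite dotE; field.
have [->|xb] := eqVneq x b.
  exists (r ^+ 2); first by rewrite expf_eq0.
  rewrite (@lreflectionE _ _ 1) ?UU /lform /= ?scE.
    by congr (_, _, _); rewrite ?scale1r ?scaler0 ?subrr//; field.
  by field.
have d0 : dot (x - b) (x - b) != 0 by rewrite dot_eq0 subr_eq0.
exists (dot (x - b) (x - b) / r ^+ 2).
  by rewrite mulf_neq0 ?invr_eq0 ?expf_eq0.
rewrite sqr_enorm; move: d0; set d := dot (x - b) (x - b) => d0.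
have xx : dot x x = d + 2 * dot x b - dot b b.
  by rewrite /d !dotE (dotC b x); ring.
rewrite (@lreflectionE _ _ (1 - d / r ^+ 2)) ?UU /lform /= ?scE.
  congr (_, _, _).
  - by rewrite !dotE (dotC b x) -/d xx; field; rewrite d0.
  - by apply/rowP => i; rewrite !mxE; field; rewrite d0.
  - by field.
by rewrite xx; field.
Qed.

Lemma lreflectionZ U k X : lreflection U (k *: X) = k *: lreflection U X.
Proof.
by rewrite /lreflection scalerBr scalerA lformZl; congr (_ - _ *: _); ring.
Qed.

(** Surjectivity is recorded so that [ball_vector] and [infty_vector] can be pulled back through
    [L]. *)
Lemma mobius_nlift (g : ext_space R n -> ext_space R n) : mobius g ->
  exists L : V -> V,
    [/\ forall X Y, lform (L X) (L Y) = lform X Y,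
        forall Y, exists X, L X = Y &
        forall p, exists2 l : R, l != 0 & L (nlift p) = l *: nlift (g p)].
Proof.
have step U L : lform U U != 0 ->
    (forall X Y, lform (L X) (L Y) = lform X Y) ->
    (forall Y, exists X, L X = Y) ->
    let L' := lreflection U \o L in
    (forall X Y, lform (L' X) (L' Y) = lform X Y) /\
    (forall Y, exists X, L' X = Y).
  move=> U0 LB LS /=; split=> [X Y|Y]; first by rewrite lform_lreflection.
  have [X XE] := LS (lreflection U Y).
  by exists X; rewrite /= XE lreflectionK.
elim=> {g} [|u t g u0 _ [L [LB LS Lg]]|b r g r0 _ [L [LB LS Lg]]].
- exists id; split=> // [Y|p]; first by exists Y.
  by exists 1; rewrite ?oner_eq0// scale1r.
- have [|LB' LS'] := step (2 * t, u, 0) L _ LB LS.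
    rewrite (_ : lform _ _ = dot u u) ?dot_eq0//.
    by rewrite /lform /= mulr0 mul0r addr0 mul0r subr0.
  exists (lreflection (2 * t, u, 0) \o L); split=> // p.
  have [l l0 E] := Lg p; exists l => //=.
  by rewrite E lreflectionZ nlift_hyperplane_reflection.
- have [|LB' LS'] := step (dot b b - r ^+ 2, b, 1) L _ LB LS.
    rewrite (_ : lform _ _ = r ^+ 2) ?expf_eq0 ?gt_eqF//.
    by rewrite /lform /=; field.
  exists (lreflection (dot b b - r ^+ 2, b, 1) \o L); split=> // p.
  have [l l0 E] := Lg p; have [m m0 F] := nlift_sphere_inversion b r (g p) r0.
  by exists (l * m); rewrite ?mulf_neq0//= E lreflectionZ F scalerA.
Qed.

(** Serves to carry inequalities from the open ball to the sphere along a radius. *)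
Lemma poly_ge0_at1 (q : {poly R}) :
  (forall t, 0 <= t < 1 -> 0 <= q.[t]) -> 0 <= q.[1].
Proof.
move=> q0.
have q1 : q.[t] @[t --> 1^'-] --> q.[1].
  by apply: cvg_at_left_filter; apply: continuous_horner.
apply: (cvgr_to_ge q1).
near=> t; apply: q0; apply/andP; split=> //.
near: t; exact: nbhs_left_ge ltr01.
Unshelve. all: by end_near. Qed.

Definition lform_poly x T : {poly R} :=
  (- T.1.1 / 2)%:P + (dot x T.1.2) *: 'X - (dot x x * T.2 / 2) *: 'X^2.

Lemma horner_lform_poly x T (t : R) :
  (lform_poly x T).[t] = lform (nlift (Some (t *: x))) T.
Proof.
rewrite /lform_poly /lform.
rewrite !(hornerD, hornerN, hornerZ, hornerC, hornerX, hornerXn).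
by rewrite /= !dotE; field.
Qed.

Definition ball_vector : V := (-2, 0, 2).
(** Pairing with this vector reads off the scalar multiplying the lift of a finite point, and
    detects infinity by the value 0. *)
Definition infty_vector : V := (-2, 0, 0).

Lemma lform_ball_vector x : lform (nlift (Some x)) ball_vector = 1 - dot x x.
Proof. by rewrite /lform /= dotE; field. Qed.

Lemma lform_infty_vector p :
  lform (nlift p) infty_vector = (if p is Some _ then 1 else 0).
Proof. by case: p => [x|]; rewrite /lform /= dotE; field. Qed.

(** * Möbius maps of the ball onto itself *)

Section BallAutomorphism.
Variables (f : 'rV[R]_n -> 'rV[R]_n) (g : ext_space R n -> ext_space R n).
Variables (L : V -> V) (T E : V).
Hypotheses (gf : forall x, unit_ball R n x -> g (Some x) = Some (f x))
  (fB : f @` unit_ball R n = unit_ball R n)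
  (LB : forall X Y, lform (L X) (L Y) = lform X Y)
  (Lg : forall p, exists2 l : R, l != 0 & L (nlift p) = l *: nlift (g p))
  (LT : L T = ball_vector) (LE : L E = infty_vector).

(** Let q and w be the pairings with [T] and [E]. Inside the ball q = l r and w = l with r in
    [0, 1], so q w >= 0 and q^2 <= w^2; both persist on the sphere. The second gives q = 0 where [g]
    takes the value infinity; the first keeps finite values in the closed ball. *)
Lemma lform_pullback_sphere x : dot x x = 1 -> lform (nlift (Some x)) T = 0.
Proof.
move=> x1.
have inball t : 0 <= t < 1 -> exists l r : R, [/\ 0 <= r <= 1,
    lform (nlift (Some (t *: x))) T = l * r &
    lform (nlift (Some (t *: x))) E = l].
  move=> /andP[t0 t1].
  have tx : unit_ball R n (t *: x) by apply/unit_ballE; rewrite !dotE x1; nra.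
  have := imageP f tx; rewrite fB => /unit_ballE ftx.
  have [l l0 Ll] := Lg (Some (t *: x)).
  exists l, (1 - dot (f (t *: x)) (f (t *: x))); split.
  - by have := dot_ge0 (f (t *: x)); lra.
  - by rewrite -LB LT Ll gf// lformZl lform_ball_vector.
  - by rewrite -LB LE Ll gf// lformZl lform_infty_vector mulr1.
have wq : 0 <= lform (nlift (Some x)) T * lform (nlift (Some x)) E.
  have := poly_ge0_at1 (lform_poly x T * lform_poly x E).
  rewrite hornerM !horner_lform_poly scale1r; apply => t /inball.
  move=> [l [r [/andP[r0 r1] Ew Eq]]].
  rewrite hornerM !horner_lform_poly Ew Eq mulrAC -expr2.
  by rewrite mulr_ge0 ?sqr_ge0.
have qw : 0 <= lform (nlift (Some x)) E ^+ 2 - lform (nlift (Some x)) T ^+ 2.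
  have := poly_ge0_at1 (lform_poly x E ^+ 2 - lform_poly x T ^+ 2).
  rewrite hornerD hornerN !horner_exp !horner_lform_poly scale1r.
  apply => t /inball.
  move=> [l [r [/andP[r0 r1] Ew Eq]]].
  rewrite hornerD hornerN !horner_exp !horner_lform_poly Ew Eq.
  rewrite exprMn -{1}(mulr1 (l ^+ 2)) -mulrBr mulr_ge0 ?sqr_ge0//.
  by rewrite subr_ge0 expr_le1.
have [l l0 Ll] := Lg (Some x).
move: wq qw; rewrite -(LB _ T) -(LB _ E) LT LE Ll !lformZl lform_infty_vector.
case gx: (g (Some x)) Ll => [y|] Ll; last first.
  rewrite mulr0 expr0n/= sub0r oppr_ge0 => _ qw.
  by apply/eqP; rewrite -(sqrf_eq0 (l * _)) eq_le qw sqr_ge0.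
rewrite lform_ball_vector mulr1 => wq _.
apply/eqP; rewrite mulf_eq0 (negPf l0)/=.
have r0 : 0 <= 1 - dot y y.
  move: wq; rewrite mulrAC -expr2 pmulr_rge0// lt0r sqrf_eq0 l0 sqr_ge0//.
apply: contraT => rn0.
have /unit_ballE yB : dot y y < 1 by rewrite -subr_gt0 lt0r rn0.
move: yB; rewrite -fB => -[z zB fz].
have [m m0 Lm] := Lg (Some z).
(* Injectivity read from the form: the lifts of x and z are sent to multiples of one null vector, so
   -|x - z|^2 / 2 = 0. *)
have := LB (nlift (Some x)) (nlift (Some z)).
rewrite Ll Lm (gf _ zB) fz lformZl lformZr !lform_nlift subrr dot0l.
rewrite oppr0 mul0r !mulr0.
move=> /esym/eqP; rewrite mulf_eq0 invr_eq0 pnatr_eq0 orbF oppr_eq0 dot_eq0.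
rewrite subr_eq0 => /eqP xz; move/unit_ballE: zB.
by rewrite -xz x1 ltxx.
Qed.

(** On the unit sphere the pairing with [T] is an affine function of x. Its vanishing at e and -e
    kills the constant term, and at the normalized linear part kills that part. Then [lform T T =
    lform ball_vector ball_vector] fixes [k] up to sign. *)
Lemma pullback_ball_vector : (0 < n)%N ->
  exists2 k : R, k ^+ 2 = 1 &
    forall x, lform (nlift (Some x)) T = k * (1 - dot x x).
Proof.
move=> n0.
have W x : dot x x = 1 -> dot x T.1.2 = (T.1.1 + T.2) / 2.
  by move=> x1; have := lform_pullback_sphere _ x1; rewrite /lform /= x1; lra.
have [e /(congr1 (fun s => s ^+ 2))] := @exists_enorm1 R n n0.
rewrite sqr_enorm expr1n => e1.
have tE : T.2 = - T.1.1.
  have := W (- e); rewrite !dotE opprK => /(_ e1).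
  by rewrite (W _ e1); lra.
have v0 : T.1.2 = 0.
  apply/eqP; apply: contraT => v0.
  have vn : enorm T.1.2 != 0 by rewrite gt_eqF ?enorm_gt0.
  have := W ((enorm T.1.2)^-1 *: T.1.2).
  rewrite !dotE -sqr_enorm tE => /(_ _)/(congr1 (fun s => s * enorm T.1.2)) h.
  have : enorm T.1.2 ^+ 2 = 0.
    have := h _; rewrite subrr !mul0r => <-; last by field.
    by field.
  by move=> /eqP; rewrite sqrf_eq0 (negPf vn).
have := LB T T; rewrite LT /lform /= v0 tE !dotE => h.
exists (- T.1.1 / 2); first by move: h; rewrite /=; lra.
by move=> x; rewrite /= dotE; field.
Qed.

(** With l, m the scalars of the two lifts, |x - y|^2 = l m |f x - f y|^2, while k (1 - |x|^2) = l
    (1 - |f x|^2) and likewise for y with m. Since k^2 = 1, multiplying gives the identity. *)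
Lemma ball_conformal x y : (0 < n)%N -> unit_ball R n x -> unit_ball R n y ->
  dot (f x - f y) (f x - f y) * ((1 - dot x x) * (1 - dot y y)) =
  dot (x - y) (x - y) * ((1 - dot (f x) (f x)) * (1 - dot (f y) (f y))).
Proof.
move=> n0 xB yB; have [k k1 kE] := pullback_ball_vector n0.
have [l l0 Ll] := Lg (Some x); have [m m0 Lm] := Lg (Some y).
have := kE x; rewrite -LB LT Ll gf// lformZl lform_ball_vector => Ex.
have := kE y; rewrite -LB LT Lm gf// lformZl lform_ball_vector => Ey.
have := LB (nlift (Some x)) (nlift (Some y)).
rewrite Ll Lm !gf// lformZl lformZr !lform_nlift => Exy.
have -> : dot (x - y) (x - y) = l * m * dot (f x - f y) (f x - f y) by lra.
transitivity (dot (f x - f y) (f x - f y) *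
  ((k * (1 - dot x x)) * (k * (1 - dot y y)))); first by ring: k1.
by rewrite -Ex -Ey; ring.
Qed.

End BallAutomorphism.

Lemma mobius_ball_conformal f x y : (0 < n)%N ->
  mobius_onto (unit_ball R n) (unit_ball R n) f ->
  unit_ball R n x -> unit_ball R n y ->
  dot (f x - f y) (f x - f y) * ((1 - dot x x) * (1 - dot y y)) =
  dot (x - y) (x - y) * ((1 - dot (f x) (f x)) * (1 - dot (f y) (f y))).
Proof.
move=> n0 [[g /mobius_nlift[L [LB LS Lg]] gf] fB].
have [T LT] := LS ball_vector; have [E LE] := LS infty_vector.
by move=> xB yB; apply: (@ball_conformal f g L T E).
Qed.

End Conformal.

(** * Boundary and boundary distance of a punctured ball *)

Section PuncturedBall.
Context {R : realType} {n : nat}.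
Implicit Types (a x y z v : 'rV[R]_n) (D : set 'rV[R]_n).

Lemma closure_segment D x v (s : R) : 0 < s ->
  (forall t, 0 < t < s -> D (x + t *: v)) -> closure D x.
Proof.
move=> s0 Dx B Bx.
have xv : x + t *: v @[t --> 0^'+] --> x.
  apply: cvg_at_right_filter.
  rewrite (_ : nbhs x = nbhs (x + 0 *: v)); last by rewrite scale0r addr0.
  by apply: cvgD; [exact: cvg_cst|exact: scalel_continuous].
have /filter_ex[t [Bt Dt]] :
    \forall t \near 0^'+, B (x + t *: v) /\ D (x + t *: v).
  apply: filterI; first exact: xv.
  have /filterS2 := @nbhs_right_gt R 0; apply; last exact: nbhs_right_lt s0.
  by move=> t t0 ts; apply: Dx; rewrite t0 ts.
by exists (x + t *: v).
Qed.

Lemma open_punctured_ball a : open (unit_ball R n `\ a).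
Proof.
apply: openI.
  apply: open_comp (@open_lt R 1) => x _; exact: enorm_continuous.
apply: closed_openC; apply: accessible_closed_set1.
exact: hausdorff_accessible (@norm_hausdorff _ _).
Qed.

Lemma boundary_punctured_ball a : (0 < n)%N -> unit_ball R n a ->
  boundary (unit_ball R n `\ a) = a |` [set z | enorm z = 1].
Proof.
move=> n0 a1; apply/seteqP; split=> [z [zD zI]|z [->|z1]].
- have z1 : enorm z <= 1.
    have : closed [set z : 'rV[R]_n | enorm z <= 1].
      apply: preimage_closed (@closed_le R 1) => x _; exact: enorm_continuous.
    move=> /closure_id E; suff : [set z : 'rV[R]_n | enorm z <= 1] z by [].
    by rewrite E; apply: closure_subset zD => x [/ltW].
  have [->|za] := eqVneq z a; first by left.
  right; apply/eqP; rewrite /= eq_le z1 leNgt; apply/negP => zB; apply: zI.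
  have /interior_id -> := open_punctured_ball a.
  by split=> //; exact/eqP.
- split; last by move=> /interior_subset[_]; exact.
  have [e e1] := @exists_enorm1 R n n0.
  apply: (@closure_segment _ _ e (1 - enorm a)) => [|t /andP[t0 t1]].
    by rewrite subr_gt0.
  split.
    rewrite /unit_ball/=; apply: le_lt_trans (enorm_triangle _ _) _.
    by rewrite enormZ e1 gtr0_norm//; lra.
  move=> /eqP; rewrite /= addrC -subr_eq0 addrK scaler_eq0 gt_eqF//=.
  by move=> /eqP e0; move: e1; rewrite e0 enorm0 => /esym/eqP; rewrite oner_eq0.
- split; last by move=> /interior_subset[]; rewrite /unit_ball/= z1 ltxx.
  (* Moving inward by less than 1 - |a| keeps the norm above |a|, so the segment avoids the
     puncture. *)
  apply: (@closure_segment _ _ (- z) (1 - enorm a)) => [|t /andP[t0 t1]].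
    by rewrite subr_gt0.
  have a0 := enorm_ge0 a.
  have zt : enorm (z + t *: - z) = 1 - t.
    rewrite scalerN -{1}(scale1r z) -scalerBl enormZ z1 mulr1 gtr0_norm//.
    by lra.
  split; first by rewrite /unit_ball/= zt; lra.
  by move=> /= za; move: zt; rewrite za => E; move: t1; rewrite E; lra.
Qed.

Lemma bdist_punctured_ball a x : (0 < n)%N -> unit_ball R n a ->
  unit_ball R n x ->
  bdist (unit_ball R n `\ a) x = Num.min (enorm (x - a)) (1 - enorm x).
Proof.
move=> n0 a1 x1; rewrite /bdist boundary_punctured_ball//.
apply/eqP; rewrite eq_le; apply/andP; split; last first.
  apply: lb_le_inf; first by exists (enorm (x - a)), a => //; left.
  move=> _ [z [->|z1] <-]; rewrite ge_min ?lexx//.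
  by rewrite -z1 (enormB x z) lerB_enorm orbT.
have lb : has_lbound
    [set enorm (x - z) | z in a |` [set z : 'rV[R]_n | enorm z = 1]].
  by exists 0 => _ [z _ <-]; exact: enorm_ge0.
rewrite le_min; apply/andP; split.
  by apply: ge_inf => //; exists a => //; left.
(* The sphere point nearest to x is x / |x|; at the origin any unit vector will do. *)
have [u u1 xu] : exists2 u : 'rV[R]_n, enorm u = 1 & x = enorm x *: u.
  have [->|x0] := eqVneq x 0.
    have [e e1] := @exists_enorm1 R n n0.
    by exists e => //; rewrite enorm0 scale0r.
  move: x0; rewrite -enorm_gt0 => x0; exists ((enorm x)^-1 *: x).
    by rewrite enormZ gtr0_norm ?invr_gt0// mulVf ?gt_eqF.
  by rewrite scalerA mulfV ?gt_eqF// scale1r.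
apply: ge_inf => //; exists u; first by right.
rewrite {1}xu -{2}(scale1r u) -scalerBl enormZ u1 mulr1 ler0_norm ?opprB//.
by rewrite subr_le0 ltW.
Qed.

End PuncturedBall.

(** * Inequalities between real numbers *)

Lemma ln_bernoulli {R : realType} (k t : R) : 1 <= k -> 0 <= t ->
  ln (1 + k * t) <= k * ln (1 + t).
Proof.
move=> k1 t0; have k0 : 0 < k by apply: lt_le_trans k1.
have kV : 0 <= k^-1 <= 1 by rewrite invr_ge0 (ltW k0) invf_le1.
have kt : 0 < 1 + k * t by rewrite ltr_pwDl// mulr_ge0// ltW.
(* Concavity of [ln] with weight 1/k at 1 + k t and 1 - 1/k at 1, whose weighted mean is 1 + t. *)
pose s : {i01 R} := Itv01 (proj1 (andP kV)) (proj2 (andP kV)).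
have := @concave_ln R s (1 + k * t) 1 kt ltr01.
rewrite !convRE ln1 mulr0 addr0 /=.
have -> : k^-1 * (1 + k * t) + (1 - k^-1) * 1 = 1 + t.
  by field; rewrite gt_eqF.
by rewrite ler_pdivrMl.
Qed.

(* Here and below r, s, d, b stand for |x|, |f x|, |f x - a|, |a|.  The triangle
   inequality confines s to [|r - b| / (1 - r b), (r + b) / (1 + r b)]. *)
Lemma ball_image_norm_bounds {R : realType} (r s d b : R) :
  0 <= r < 1 -> 0 <= s < 1 -> 0 <= b < 1 -> 0 <= d ->
  d ^+ 2 * (1 - r ^+ 2) = r ^+ 2 * ((1 - s ^+ 2) * (1 - b ^+ 2)) ->
  s - b <= d -> b - s <= d -> d <= s + b ->
  s * (1 + r * b) <= r + b /\
  (1 - s ^+ 2) * (1 - r * b) ^+ 2 <= (1 - r ^+ 2) * (1 - b ^+ 2).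
Proof.
move=> /andP[r0 r1] /andP[s0 s1] /andP[b0 b1] d0 dE sbd bsd dsb.
have rr : 0 <= 1 - r ^+ 2 by nra.
have sb1 : 0 <= 1 - s * b by nra.
have rb1 : 0 <= 1 - r * b by nra.
(* Substituting |s - b| <= d in the relation for d and using (1 - s b)^2 - (s - b)^2 = (1 - s^2)(1 -
   b^2) gives |s - b| <= r (1 - s b). The bound [up] comes likewise from d <= s + b, with plus signs
   in the identity. *)
have [lo lo'] : - (r * (1 - s * b)) <= s - b /\ s - b <= r * (1 - s * b).
  apply/andP; rewrite -ler_norml -(ler_pXn2r (_ : 0 < 2)%N) ?nnegrE ?mulr_ge0//.
  rewrite -normrX ger0_norm ?sqr_ge0//.
  have sb2 : (s - b) ^+ 2 <= d ^+ 2 by nra.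
  by have := ler_wpM2r rr sb2; rewrite dE; lra.
have up : r * (1 + s * b) <= s + b.
  rewrite -(ler_pXn2r (_ : 0 < 2)%N) ?nnegrE ?mulr_ge0 ?addr_ge0 ?mulr_ge0//.
  have d2 : d ^+ 2 <= (s + b) ^+ 2 by nra.
  by have := ler_wpM2r rr d2; rewrite dE; lra.
split; first by lra.
have s_lo : `|r - b| <= s * (1 - r * b).
  by rewrite ler_norml; apply/andP; split; lra.
(* The conclusion follows by (1 - r b)^2 - (r - b)^2 = (1 - r^2)(1 - b^2). *)
have : (r - b) ^+ 2 <= (s * (1 - r * b)) ^+ 2.
  by rewrite -(@real_normK _ (r - b)) ?num_real// lerXn2r ?nnegrE ?mulr_ge0.
by lra.
Qed.

Lemma minr_onem_le {R : realType} (r b : R) : 0 <= r < 1 -> 0 <= b < 1 ->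
  Num.min r (1 - r) <= (1 + b) * r * (1 - r * b).
Proof.
move=> /andP[r0 r1] /andP[b0 b1]; have [rh|rh] := leP r (1 - r).
  (* As r <= 1/2, the product is at least (1 + b)(1 - b/2) = 1 + b (1 - b) / 2. *)
  have h : 1 <= (1 + b) * (1 - r * b) by nra.
  by have := ler_wpM2l r0 h; lra.
(* The right side minus 1 - r is concave in r: interpolate between r = 1/2 and
   r = 1. *)
have r2 : 0 <= 2 * r - 1 by lra.
have r3 : 0 <= 1 - r by lra.
have b2 : 0 <= 1 - b by lra.
have b3 : 0 <= 1 + b by lra.
have t1 := mulr_ge0 r2 (mulr_ge0 b2 b3).
have t2 := mulr_ge0 r3 (mulr_ge0 b0 b2).
have t3 := mulr_ge0 (mulr_ge0 r2 r3) (mulr_ge0 b0 b3).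
by clear -t1 t2 t3; lra.
Qed.

(** Each argument of the minimum on the right is treated apart. For d, both sides are squared;
    [minr_onem_le] and the lower bound on s reduce the claim to the relation for d. *)
Lemma distortion_bound {R : realType} (r s d b : R) :
  0 <= r < 1 -> 0 <= s < 1 -> 0 <= b < 1 -> 0 <= d ->
  d ^+ 2 * (1 - r ^+ 2) = r ^+ 2 * ((1 - s ^+ 2) * (1 - b ^+ 2)) ->
  s - b <= d -> b - s <= d -> d <= s + b ->
  (1 - s ^+ 2) * Num.min r (1 - r) <=
    (1 + b) * (1 - r ^+ 2) * Num.min d (1 - s).
Proof.
move=> r01 s01 b01 d0 dE sbd bsd dsb.
have [s_up s_lo] :=
  ball_image_norm_bounds _ _ _ _ r01 s01 b01 d0 dE sbd bsd dsb.
have mb := minr_onem_le _ _ r01 b01.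
move: r01 s01 b01 => /andP[r0 r1] /andP[s0 s1] /andP[b0 b1].
have rr : 0 <= 1 - r ^+ 2 by nra.
have ss : 0 <= 1 - s ^+ 2 by nra.
have rb0 : 0 <= r * b by rewrite mulr_ge0.
have rb1 : 0 <= 1 - r * b by nra.
have m0 : 0 <= Num.min r (1 - r) by rewrite le_min r0 subr_ge0 ltW.
have b2 : 0 <= 1 + b by rewrite addr_ge0.
rewrite [leRHS]minr_pMr ?mulr_ge0// le_min; apply/andP; split.
  rewrite -(ler_pXn2r (_ : 0 < 2)%N) ?nnegrE ?mulr_ge0//.
  have m2 : Num.min r (1 - r) ^+ 2 <= ((1 + b) * r * (1 - r * b)) ^+ 2.
    by rewrite lerXn2r ?nnegrE ?mulr_ge0.
  rewrite exprMn; apply: (le_trans (ler_wpM2l (sqr_ge0 _) m2)).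
  have A0 : 0 <= (1 - s ^+ 2) * ((1 + b) * r) ^+ 2 by rewrite mulr_ge0 ?sqr_ge0.
  have -> : (1 - s ^+ 2) ^+ 2 * ((1 + b) * r * (1 - r * b)) ^+ 2 =
      (1 - s ^+ 2) * ((1 + b) * r) ^+ 2 *
      ((1 - s ^+ 2) * (1 - r * b) ^+ 2) by ring.
  apply: (le_trans (ler_wpM2l A0 s_lo)).
  rewrite le_eqVlt; apply/orP; left; apply/eqP.
  transitivity ((1 + b) ^+ 2 * (1 - r ^+ 2) *
    (r ^+ 2 * ((1 - s ^+ 2) * (1 - b ^+ 2)))); first by ring.
  by rewrite -dE; ring.
have h : (1 - s ^+ 2) * Num.min r (1 - r) <= (1 - s ^+ 2) * (1 - r).
  by rewrite ler_wpM2l// ge_min lexx orbT.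
apply: (le_trans h).
(* After cancelling (1 - s)(1 - r) this is all that remains; it follows from s <= s (1 + r b) <= r +
   b. *)
have h2 : 1 + s <= (1 + b) * (1 + r).
  have : s <= s * (1 + r * b) by rewrite mulrDr mulr1 lerDl mulr_ge0.
  by lra.
have h3 : 0 <= (1 - s) * (1 - r) by rewrite mulr_ge0// subr_ge0 ltW.
by have := ler_wpM2r h3 h2; lra.
Qed.

Lemma ln_le_of_le_mul {R : realType} (k c t u : R) : 1 <= k -> 0 <= c ->
  0 <= t -> 0 <= u -> t <= k * u -> ln (1 + c * t) <= k * ln (1 + c * u).
Proof.
move=> k1 c0 t0 u0 tu; have cu := mulr_ge0 c0 u0.
apply: le_trans (ln_bernoulli _ _ k1 cu).
have ct := mulr_ge0 c0 t0; have ctu := ler_wpM2l c0 tu.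
by rewrite ler_ln ?posrE; lra.
Qed.

(** * Distortion of the boundary distances and of the metric *)

Section Distortion.
Context {R : realType} {n : nat}.
Implicit Types (a x y : 'rV[R]_n).

Lemma bdist_punctured_ball_gt0 a x : (0 < n)%N -> unit_ball R n a ->
  (unit_ball R n `\ a) x -> 0 < bdist (unit_ball R n `\ a) x.
Proof.
move=> n0 a1 [x1 xa]; rewrite bdist_punctured_ball// lt_min enorm_gt0 subr_eq0.
by rewrite subr_gt0 andbC; apply/andP; split=> //; exact/eqP.
Qed.

(** The conformal identity for the pair x, 0 supplies the relation for |f x - f 0| required by
    [distortion_bound]. *)
Lemma mobius_ball_bdist f x : (0 < n)%N ->
  mobius_onto (unit_ball R n) (unit_ball R n) f -> unit_ball R n x ->
  (1 - dot (f x) (f x)) * bdist (unit_ball R n `\ 0) x <=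
  (1 + enorm (f 0)) * (1 - dot x x) * bdist (unit_ball R n `\ f 0) (f x).
Proof.
move=> n0 fM xB; have [_ fB] := fM.
have B0 : unit_ball R n 0 by rewrite /unit_ball/= enorm0.
have f0B : unit_ball R n (f 0) by rewrite -fB; exists 0.
have fxB : unit_ball R n (f x) by rewrite -fB; exists x.
rewrite !bdist_punctured_ball// subr0 -!sqr_enorm.
apply: distortion_bound; rewrite ?enorm_ge0//.
- have := mobius_ball_conformal f x 0 n0 fM xB B0.
  by rewrite subr0 dot0l subr0 mulr1 -!sqr_enorm.
- exact: lerB_enorm.
- by rewrite enormB lerB_enorm.
- by rewrite -[enorm (f 0)]enormN enorm_triangle.
Qed.

(** Squared and multiplied by (1 - |x|^2)(1 - |y|^2), the claim is the product of the estimates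
    [mobius_ball_bdist] at x and y, once the conformal identity has replaced |f x - f y|^2. *)
Lemma mobius_ball_enorm_bdist f x y : (0 < n)%N ->
  mobius_onto (unit_ball R n) (unit_ball R n) f ->
  (unit_ball R n `\ 0) x -> (unit_ball R n `\ 0) y ->
  enorm (f x - f y) / Num.sqrt (bdist (unit_ball R n `\ f 0) (f x)
                                * bdist (unit_ball R n `\ f 0) (f y)) <=
  (1 + enorm (f 0)) * (enorm (x - y) /
    Num.sqrt (bdist (unit_ball R n `\ 0) x * bdist (unit_ball R n `\ 0) y)).
Proof.
move=> n0 fM xD yD; have [_ fB] := fM.
pose D := unit_ball R n `\ f 0.
have B0 : unit_ball R n 0 by rewrite /unit_ball/= enorm0.
have f0B : unit_ball R n (f 0) by rewrite -fB; exists 0.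
have inD z : (unit_ball R n `\ 0) z ->
    [/\ unit_ball R n z, 0 < 1 - dot z z, 0 < 1 - dot (f z) (f z) & D (f z)].
  move=> [zB z0].
  have fzB : unit_ball R n (f z) by rewrite -fB; exists z.
  have z1 : 0 < 1 - dot z z by rewrite subr_gt0; apply/unit_ballE.
  have fz1 : 0 < 1 - dot (f z) (f z) by rewrite subr_gt0; apply/unit_ballE.
  split=> //; split=> //= fz0.
  (* If f z = f 0, the conformal identity equates 0 with |z|^2 times positive factors. *)
  have := mobius_ball_conformal f z 0 n0 fM zB B0.
  rewrite fz0 subrr dot0l mul0r => /esym/eqP.
  rewrite subr0 mulf_eq0 mulf_eq0 -fz0 (gt_eqF fz1) !orbF dot_eq0.
  by move=> /eqP; exact: z0.
have [xB x1 fx1 fxD] := inD x xD; have [yB y1 fy1 fyD] := inD y yD.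
have dx := bdist_punctured_ball_gt0 0 x n0 B0 xD.
have dy := bdist_punctured_ball_gt0 0 y n0 B0 yD.
have ex := bdist_punctured_ball_gt0 (f 0) (f x) n0 f0B fxD.
have ey := bdist_punctured_ball_gt0 (f 0) (f y) n0 f0B fyD.
have hx := mobius_ball_bdist f x n0 fM xB.
have hy := mobius_ball_bdist f y n0 fM yB.
have conf := mobius_ball_conformal f x y n0 fM xB yB.
rewrite -/D in hx hy ex ey *; move: hx hy dx dy ex ey.
set p := bdist _ x; set q := bdist _ y.
set p' := bdist D (f x); set q' := bdist D (f y).
set k := 1 + enorm (f 0); move=> hx hy dx dy ex ey.
have k0 : 0 <= k by rewrite addr_ge0 ?enorm_ge0.
rewrite mulrA ler_pdivrMr ?sqrtr_gt0 ?mulr_gt0// mulrAC.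
rewrite ler_pdivlMr ?sqrtr_gt0 ?mulr_gt0//.
rewrite -(ler_pXn2r (_ : 0 < 2)%N) ?nnegrE ?mulr_ge0 ?enorm_ge0 ?sqrtr_ge0//.
rewrite !exprMn !sqr_enorm !sqr_sqrtr ?mulr_ge0
  ?(ltW dx, ltW dy, ltW ex, ltW ey)//.
rewrite -(ler_pM2r (mulr_gt0 x1 y1)).
have := ler_pM (mulr_ge0 (ltW fx1) (ltW dx)) (mulr_ge0 (ltW fy1) (ltW dy))
  hx hy.
have dge0 := dot_ge0 (x - y).
move=> /(ler_wpM2l dge0) h.
have -> : dot (f x - f y) (f x - f y) * (p * q) *
      ((1 - dot x x) * (1 - dot y y)) =
    dot (x - y) (x - y) *
      ((1 - dot (f x) (f x)) * p * ((1 - dot (f y) (f y)) * q)).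
  by rewrite mulrAC conf; ring.
by apply: le_trans h _; rewrite le_eqVlt; apply/orP; left; apply/eqP; ring.
Qed.

End Distortion.

Theorem theorem1p4 (R : realType) (n : nat) (c : R) (a : 'rV[R]_n)
    (f : 'rV[R]_n -> 'rV[R]_n) :
  (2 <= n)%N -> 2 <= c -> unit_ball R n a ->
  mobius_onto (unit_ball R n) (unit_ball R n) f -> f 0 = a ->
  forall x y : 'rV[R]_n,
    (unit_ball R n `\ 0) x -> (unit_ball R n `\ 0) y ->
    hmetric (unit_ball R n `\ a) c (f x) (f y)
      <= (1 + enorm a) * hmetric (unit_ball R n `\ 0) c x y.
Proof.
move=> n2 c2 _ fM <- x y xD yD.
apply: ln_le_of_le_mul.
- by rewrite lerDl enorm_ge0.
- exact: le_trans c2.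
- by rewrite divr_ge0 ?enorm_ge0 ?sqrtr_ge0.
- by rewrite divr_ge0 ?enorm_ge0 ?sqrtr_ge0.
- exact: (mobius_ball_enorm_bdist f x y (ltnW n2) fM xD yD).
Qed.
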